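(* Let $\mathcal{I}:I\to\mathbb{R}$ be a $d$-dimensional grayscale digital image, $N>\max_{p\in I}\mathcal{I}(p)$, and $\mathcal{I}^{\mathbf P}:I^{\mathbf P}\to\mathbb{R}$ the image padded with the value $N$. Then: 1. The filtered complexes $(T(I)\sqcup_{\partial T(I)}\kappa^{(d)},\widehat{T}(\mathcal{I}))$ and $(V(I^{\mathbf P})/\partial V(I^{\mathbf P}),\widetilde{V}(-\mathcal{I}^{\mathbf P}))$ are dual. 2. The filtered complexes $(V(I^{\mathbf P})\sqcup_{\partial V(I^{\mathbf P})}\kappa^{(d)},\widehat{V}(\mathcal{I}^{\mathbf P}))$ and $(T(I^{\mathbf P})/\partial T(I^{\mathbf P}),\widetilde{T}(-\mathcal{I}^{\mathbf P}))$ are dual.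
   Context: Cell complexes: a cell complex is a finite regular CW-complex; $\tau\preceq\sigma$ means $\tau\subseteq\overline\sigma$ ($\tau$ is a face of $\sigma$). A filtered complex $(X,f)$ is a cell complex with a function $f$ on its cells that is monotonic: $\sigma\preceq\tau\Rightarrow f(\sigma)\le f(\tau)$. A linear ordering $\sigma_0,\dots,\sigma_n$ of the cells such that $\sigma_i\preceq\sigma_j$ implies $i\le j$ is compatible with $f$ if $f(\sigma_0)\le\dots\le f(\sigma_n)$. Two $d$-dimensional cell complexes $X,X^*$ are combinatorially dual if there is a bijection $\sigma\mapsto\sigma^*$ between their sets of cells with $\dim\sigma^*=d-\dim\sigma$ and $\sigma\preceq\tau\iff\tau^*\preceq\sigma^*$. Filtered complexes $(X,f)$ and $(X^*,g)$ are dual if $X$ and $X^*$ are combinatorially dual and there is an ordering $\sigma_0,\dots,\sigma_n$ of the cells of $X$ compatible with $f$ such that $\sigma_n^*,\dots,\sigma_0^*$ is compatible with $g$. Images: a $d$-dimensional grayscale digital image ($d\ge1$) is a function $\mathcal{I}:I\to\mathbb{R}$, $I=\{1,\dots,n_1\}\times\dots\times\{1,\dots,n_d\}$. The padded image $\mathcal{I}^{\mathbf P}$ has domain $I^{\mathbf P}=\{0,\dots,n_1+1\}\times\dots\times\{0,\dots,n_d+1\}$, equals $\mathcal{I}$ on $I$ and equals $N$ on $I^{\mathbf P}\setminus I$; $-\mathcal{I}^{\mathbf P}$ is its pointwise negative. V-construction: for an image $\mathcal{J}:J\to\mathbb{R}$ on a grid $J$ of size $(m_1,\dots,m_d)$,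 $V(J)$ is the cubical complex of the array of $(m_1-1)\times\dots\times(m_d-1)$ unit $d$-cubes and all their faces, with vertices indexed exactly by $J$; $V(\mathcal{J})$ equals $\mathcal{J}(p)$ on the vertex indexed by $p$ and on a cube is the maximum of the values on its vertices. T-construction: $T(J)$ is the cubical complex of the array of $m_1\times\dots\times m_d$ unit $d$-cubes and all their faces, with $d$-cubes indexed exactly by $J$ (the cube of $p$ being, up to translation, $\prod_i[p_i-\frac12,p_i+\frac12]$); $T(\mathcal{J})$ equals $\mathcal{J}(p)$ on the $d$-cube indexed by $p$ and on a cube $\sigma$ is the minimum of the values on the $d$-cubes containing $\sigma$ as a face. Modifications: for $Y=T(I)$ or $Y=V(I^{\mathbf P})$, $\partial Y$ is the boundary of the underlying box and $Y\sqcup_{\partial Y}\kappa^{(d)}$ is obtained by attaching one $d$-cell $\kappa^{(d)}$ along $\partial Y$ (by a homeomorphism from the boundary sphere of the $d$-ball onto $\partial Y$). The functions $\widehat{T}(\mathcal{I})$ on $T(I)\sqcup_{\partial T(I)}\kappa^{(d)}$ and $\widehat{V}(\mathcal{I}^{\mathbf P})$ on $V(I^{\mathbf P})\sqcup_{\partial V(I^{\mathbf P})}\kappa^{(d)}$ extend $T(\mathcal{I})$, respectively $V(\mathcal{I}^{\mathbf P})$, by the value $N$ on $\kappa^{(d)}$. For $Y=V(I^{\mathbf P})$ or $Y=T(I^{\mathbf P})$, $Y/\partial Y$ is the quotient cell complex identifying $\partial Y$ to a single point; its cells are the cells of $Y$ not in $\partial Y$ together with a $0$-cell $[\partial Y]$.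 The functions $\widetilde{V}(-\mathcal{I}^{\mathbf P})$ on $V(I^{\mathbf P})/\partial V(I^{\mathbf P})$ and $\widetilde{T}(-\mathcal{I}^{\mathbf P})$ on $T(I^{\mathbf P})/\partial T(I^{\mathbf P})$ are those induced by $V(-\mathcal{I}^{\mathbf P})$ and $T(-\mathcal{I}^{\mathbf P})$ (which are constant equal to $-N$ on the boundary): they take the value $-N$ on $[\partial Y]$ and agree with $V(-\mathcal{I}^{\mathbf P})$, respectively $T(-\mathcal{I}^{\mathbf P})$, on all other cells. *)

(* Defs.v *)
From HB Require Import structures.
From mathcomp Require Import all_boot all_order all_algebra generic_quotient.
From mathcomp Require Import all_classical all_reals topology normedtype.
Set Implicit Arguments.
Unset Strict Implicit.
Unset Printing Implicit Defensive.
Import Order.TTheory GRing.Theory Num.Theory.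
Import numFieldNormedType.Exports.
Local Open Scope classical_set_scope.
Local Open Scope ring_scope.

(* The data of a finite cell complex: a topological space and its finitely    *)
(* many open cells.  The regular CW axioms are not part of the record: the    *)
(* notions of face, filtration and duality only involve the cells, their      *)
(* dimensions and their closures.                                             *)
Record cell_complex := CellComplex {
  total_space :> topologicalType;
  cells : finType;
  cell : cells -> set total_space;
  cell_dim : cells -> nat }.

Definition face (X : cell_complex) (t s : cells X) : Prop :=
  cell t `<=` closure (cell s).
Arguments face : clear implicits.

Definition dimension (X : cell_complex) : nat :=
  (\max_(c : cells X) cell_dim c)%N.

Definition combinatorial_duality (d : nat) (X Y : cell_complex)
    (star : cells X -> cells Y) : Prop :=
  [/\ dimension X = d, dimension Y = d, bijective star,
      forall s, (cell_dim (star s) + cell_dim s = d)%N &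
      forall s t, face X s t <-> face Y (star t) (star s)].

Section Filtrations.
Context {R : realType}.

Definition monotonic (X : cell_complex) (f : cells X -> R) : Prop :=
  forall s t, face X s t -> f s <= f t.

Definition compatible (X : cell_complex) (f : cells X -> R)
    (o : seq (cells X)) : Prop :=
  [/\ perm_eq o (enum (cells X)),
      forall s t, face X s t -> (index s o <= index t o)%N &
      sorted <=%R [seq f s | s <- o]].

Definition dual_filtered (d : nat) (X Y : cell_complex)
    (f : cells X -> R) (g : cells Y -> R) : Prop :=
  [/\ monotonic f, monotonic g &
      exists2 star : cells X -> cells Y, combinatorial_duality d star &
      exists2 o : seq (cells X), compatible f o &
        compatible g (rev [seq star s | s <- o])].

End Filtrations.
Arguments dual_filtered {R} d X Y f g.

Section Cubical.
Context {R : realType} {d : nat}.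

Definition box (a : 'rV[R]_d) (k : 'I_d -> nat) : set 'rV[R]_d :=
  [set x | forall i, a 0 i <= x 0 i <= a 0 i + (k i)%:R].

(* Elementary intervals of the subdivision of [a, a + k] into unit segments:  *)
(* [inl j] is the point a + j and [inr j] the open edge ]a + j, a + j + 1[.   *)
Definition elementary (a : R) (k : nat) (e : 'I_k.+1 + 'I_k) : set R :=
  match e with
  | inl j => [set a + j%:R]
  | inr j => `]a + j%:R, a + j.+1%:R[
  end.

Definition is_edge (k : nat) (e : 'I_k.+1 + 'I_k) : bool :=
  if e is inr _ then true else false.

Definition cube_index (k : 'I_d -> nat) : finType :=
  {dffun forall i : 'I_d, ('I_(k i).+1 + 'I_(k i))%type}.

(* The array of k_1 x ... x k_d unit cubes with lowest corner a.              *)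
Definition box_complex (a : 'rV[R]_d) (k : 'I_d -> nat) : cell_complex :=
  @CellComplex (set_type (box a k)) (cube_index k)
    (fun c => [set x : set_type (box a k) |
       forall i, elementary (a 0 i) (c i) ((set_val x : 'rV[R]_d) 0 i)])
    (fun c => #|[set i | is_edge (c i)]%SET|).

Definition box_boundary (a : 'rV[R]_d) (k : 'I_d -> nat) :
    set (box_complex a k) :=
  [set x : set_type (box a k) | ~ interior (box a k) (set_val x)].

End Cubical.

Section Images.
Context {R : realType} {d : nat}.
Implicit Types lo hi n : 'I_d -> nat.

Definition in_grid lo hi : pred {ffun 'I_d -> nat} :=
  fun p => [forall i, lo i <= p i <= hi i]%N.

Definition grid lo hi : Type := {p : {ffun 'I_d -> nat} | in_grid lo hi p}.

Definition padded n (I : grid (fun=> 1%N) n -> R) (N : R) :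
    grid (fun=> 0%N) (fun i => (n i).+1) -> R :=
  fun q => if insub (val q) is Some p then I p else N.

Definition grid_point lo hi (p : grid lo hi) : 'rV[R]_d :=
  \row_i ((val p i)%:R).

Definition unit_cube_at lo hi (p : grid lo hi) : set 'rV[R]_d :=
  [set x | forall i, (val p i)%:R - 2^-1 < x 0 i < (val p i)%:R + 2^-1].

Definition Vcorner lo : 'rV[R]_d := \row_i ((lo i)%:R).
Definition Vsize lo hi (i : 'I_d) : nat := (hi i - lo i)%N.
Definition Vcomplex lo hi : cell_complex :=
  box_complex (Vcorner lo) (Vsize lo hi).
Definition Vboundary lo hi : set (Vcomplex lo hi) :=
  @box_boundary R d (Vcorner lo) (Vsize lo hi).

Definition Tcorner lo : 'rV[R]_d := \row_i ((lo i)%:R - 2^-1).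
Definition Tsize lo hi (i : 'I_d) : nat := ((hi i).+1 - lo i)%N.
Definition Tcomplex lo hi : cell_complex :=
  box_complex (Tcorner lo) (Tsize lo hi).
Definition Tboundary lo hi : set (Tcomplex lo hi) :=
  @box_boundary R d (Tcorner lo) (Tsize lo hi).

(* [sup] and [inf] are taken over finite nonempty sets of values, hence are a *)
(* maximum and a minimum.                                                     *)
Definition Vfun lo hi (J : grid lo hi -> R) (c : cells (Vcomplex lo hi)) : R :=
  sup [set J p | p in [set p | exists2 v : cells (Vcomplex lo hi),
         set_val @` cell v = [set grid_point p] & face _ v c]].

Definition Tfun lo hi (J : grid lo hi -> R) (c : cells (Tcomplex lo hi)) : R :=
  inf [set J p | p in [set p | exists2 q : cells (Tcomplex lo hi),
         set_val @` cell q = unit_cube_at p & face _ c q]].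

End Images.

Arguments Vcomplex R {d} lo hi.
Arguments Tcomplex R {d} lo hi.
Arguments Vboundary R {d} lo hi.
Arguments Tboundary R {d} lo hi.

Section Quotient.
Context (X : cell_complex) (A : set X).
Local Open Scope quotient_scope.

Definition collapse_rel (x y : X) : bool := `[< x = y \/ (A x /\ A y) >].

Lemma collapse_refl : reflexive collapse_rel.
Proof. by move=> x; apply/asboolP; left. Qed.

Lemma collapse_sym : symmetric collapse_rel.
Proof.
by move=> x y; apply/asboolP/asboolP => -[->|[]]; [left|right|left|right].
Qed.

Lemma collapse_trans : transitive collapse_rel.
Proof.
move=> y x z /asboolP[->//|[Ax Ay]] /asboolP[<-|[_ Az]]; apply/asboolP;
  by right.
Qed.

Canonical collapse_equiv :=
  EquivRel collapse_rel collapse_refl collapse_sym collapse_trans.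

Definition collapse_space : topologicalType :=
  quotient_topology {eq_quot collapse_rel}.

Definition collapse_proj : X -> collapse_space := \pi_{eq_quot collapse_rel}.

(* [None] is the 0-cell [A]; [Some c] is a cell c of X not contained in A.    *)
Definition collapse : cell_complex :=
  @CellComplex collapse_space
    (option {c : cells X | ~~ `[< cell c `<=` A >]})
    (fun o => collapse_proj @` (if o is Some c then cell (val c) else A))
    (fun o => if o is Some c then cell_dim (val c) else 0%N).

Definition collapse_fun (R : Type) (f : cells X -> R) (b : R) :
    cells collapse -> R :=
  fun o => if o is Some c then f (val c) else b.

End Quotient.
Arguments collapse : clear implicits.
Arguments collapse_fun {X} A {R} f b.

Section Disk.
Context (R : realType) (d : nat).

Definition disk : set 'rV[R]_d := [set x | \sum_i x 0 i ^+ 2 <= 1].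
Definition sphere : set 'rV[R]_d := [set x | \sum_i x 0 i ^+ 2 = 1].

End Disk.
Arguments disk : clear implicits.
Arguments sphere : clear implicits.

Definition homeomorphism (S T : topologicalType) (A : set S) (B : set T)
    (h : A -> B) : Prop :=
  continuous h /\
  exists g : B -> A, [/\ continuous g, cancel h g & cancel g h].

Section Attach.
Context {R : realType} (d : nat) (X : cell_complex) (A : set X).
Context (h : sphere R d -> A).
Local Open Scope quotient_scope.

Definition attach_part (b : bool) : topologicalType :=
  if b then total_space X else set_type (disk R d).

Definition attach_sum : topologicalType := {b : bool & attach_part b}.

Definition from_base (x : X) : attach_sum := existT attach_part true x.
Definition from_disk (x : disk R d) : attach_sum :=
  existT attach_part false x.

(* The gluing identifies s on the sphere with h s: [attach_nf] sends a point  *)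
(* of the disjoint union to the canonical representative of its class.        *)
Definition attach_nf (z : attach_sum) : attach_sum :=
  match z with
  | existT true x => from_base x
  | existT false x =>
      if insub (set_val x) is Some s then from_base (set_val (h s))
      else from_disk x
  end.

Definition attach_rel (z w : attach_sum) : bool := attach_nf z == attach_nf w.

Lemma attach_refl : reflexive attach_rel.
Proof. by move=> z; exact: eqxx. Qed.

Lemma attach_sym : symmetric attach_rel.
Proof. by move=> z w; exact: eq_sym. Qed.

Lemma attach_trans : transitive attach_rel.
Proof. by move=> w z t /eqP zw /eqP wt; apply/eqP; rewrite zw. Qed.

Canonical attach_equiv :=
  EquivRel attach_rel attach_refl attach_sym attach_trans.

Definition attach_space : topologicalType :=
  quotient_topology {eq_quot attach_rel}.

Definition attach_proj : attach_sum -> attach_space :=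
  \pi_{eq_quot attach_rel}.

(* [None] is the new d-cell, the image of the open disk.                      *)
Definition attach : cell_complex :=
  @CellComplex attach_space (option (cells X))
    (fun o => if o is Some c then (attach_proj \o from_base) @` cell c
      else (attach_proj \o from_disk) @` [set x | ~ sphere R d (set_val x)])
    (fun o => if o is Some c then cell_dim c else d).

Definition attach_fun (f : cells X -> R) (b : R) : cells attach -> R :=
  fun o => if o is Some c then f c else b.

End Attach.
Arguments attach_fun {R d X A} h f b.

(* Main.v *)
Require Import Defs.
From mathcomp Require Import all_boot all_order all_algebra generic_quotient.
From mathcomp Require Import all_classical all_reals topology normedtype.
From mathcomp Require Import zify ring lra.
Set Implicit Arguments.
Unset Strict Implicit.
Unset Printing Implicit Defensive.
Import Order.TTheory GRing.Theory Num.Theory.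
Import numFieldNormedType.Exports.
Local Open Scope classical_set_scope.
Local Open Scope ring_scope.

(* Encode a cube of a box with k_i unit segments along axis i by its doubled  *)
(* coordinates m_i in {0, ..., 2 k_i}, odd exactly along the edges of the     *)
(* cube.  Then m is a face of m' iff, for each i, m_i = m'_i or m'_i is odd   *)
(* and |m_i - m'_i| = 1.  The shift m |-> m + 1 reverses this relation and    *)
(* maps the cubes of the box bijectively onto the interior cubes of a box     *)
(* with one more segment along each axis.  A cube lies in the boundary iff    *)
(* the closure of its shift meets the boundary of the larger box, which is    *)
(* what is needed to match the attached d-cell with the collapsed boundary.   *)
(* The shift turns incidence with a voxel into incidence with a vertex, so    *)
(* the two filtrations are opposite to each other, the padding value being    *)
(* irrelevant for the extrema in the first case.  A common compatible order   *)
(* is then obtained by sorting the cells by value, and by dimension among     *)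
(* cells of equal value.                                                      *)

(** * Closures in attaching and quotient spaces *)

(** Both statements are instances of [box_dual_filtered], which relates a box with k_i segments
    along axis i to one with k_i + 1. The arithmetic of codes describes the topological face
    relation: [face_boxE] does this inside a box, [face_attach_base] and [face_attach_top] after
    attaching the d-cell, [face_collapse_cells] and [face_collapse_point] after collapsing the
    boundary. [dual_cell_face] combines them into a duality.

    On values, [Vfun_dual] and [Tfun_dual] show that the dual filtration is the negative of the
    original one. [dual_filtered_opp] then produces a single order of the cells that serves both
    sides, read backwards on the dual. *)

Lemma closure_sub_closed (T : topologicalType) (A F : set T) :
  closed F -> A `<=` F -> closure A `<=` F.
Proof. by move=> /closure_id {2}->; exact: closure_subset. Qed.

Lemma closure_image (S T : topologicalType) (f : S -> T) (A : set S) x :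
  continuous f -> closure A x -> closure (f @` A) (f x).
Proof.
move=> /continuous_closedP fC.
apply: (@closure_sub_closed _ A (f @^-1` closure (f @` A))).
  by apply: fC; exact: closed_closure.
by move=> y Ay; apply: subset_closure; exists y.
Qed.

(** Saturation makes P the preimage of its own image, so that image is closed in the quotient. Upper
    bounds on closures in glued or collapsed complexes come from choosing a suitable P. *)
Lemma pi_closure_saturated (T : topologicalType) (Q : quotType T)
    (B P : set T) (x : T) :
  closed P ->
  (forall y z, (y = z %[mod quotient_topology Q])%qT -> P y -> P z) ->
  B `<=` P ->
  closure ((\pi_(quotient_topology Q) : T -> quotient_topology Q)%qT @` B)
    (\pi_(quotient_topology Q) x)%qT -> P x.
Proof.
move=> cP satP BP.
pose F : set (quotient_topology Q) := (\pi_(quotient_topology Q) @` P)%qT.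
have FP : (\pi_(quotient_topology Q) @^-1` F)%qT = P.
  apply/seteqP; split=> [y|y Py]; last by exists y.
  by case=> z Pz zy; exact: satP zy Pz.
have cF : closed F.
  rewrite -openC /open /= /quotient_open preimage_setC openC.
  by move: cP; rewrite -{1}FP.
move=> /(closure_sub_closed cF) -[|y Py yx]; last exact: satP yx Py.
by move=> _ [y By <-]; exists y => //; exact: BP.
Qed.

Section BoxTopology.
Context {R : realType} {d : nat}.
Implicit Types (B : set 'rV[R]_d).

Lemma set_val_continuous B : continuous (set_val : set_type B -> 'rV[R]_d).
Proof. exact: initial_continuous. Qed.

Lemma subcoord_continuous B i :
  continuous (fun x : set_type B => (set_val x : 'rV[R]_d) 0 i).
Proof.
move=> x.
apply: (@continuous_comp _ _ _ (@set_val _ B) (fun v : 'rV[R]_d => v 0 i)).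
  exact: set_val_continuous.
exact: coord_continuous.
Qed.

(** The points of a segment shrinking towards x converge to x. *)
Lemma segment_closure B (A : set (set_type B)) (x : set_type B) (v : 'rV[R]_d) :
  (forall t, 0 < t -> t <= 1 ->
     exists2 z, A z & forall i, set_val z 0 i =
       set_val x 0 i + t * (v 0 i - set_val x 0 i)) ->
  closure A x.
Proof.
move=> H U [V [[W oW <-] Wx] VU].
have /nbhs_ballP[e /= e0 eW] : nbhs (set_val x) W by exact: open_nbhs_nbhs.
pose M := \sum_i `|v 0 i - set_val x 0 i|.
have M0 : 0 <= M by apply: sumr_ge0.
have eM : 0 < e + M by rewrite ltr_pwDl.
(* This ratio is positive, at most 1, and makes t * M smaller than e, where M bounds every
   coordinate of the displacement. *)
have [||z Az zE] := H (e / (e + M)).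
- exact: divr_gt0.
- by rewrite ler_pdivrMr// mul1r lerDl.
exists z; split=> //; apply: VU; apply: eW; split=> // i j.
rewrite /ball/= ord1 zE opprD addNKr normrN normrM gtr0_norm ?divr_gt0//.
rewrite mulrAC ltr_pdivrMr// ltr_pM2l//.
rewrite ltr_pwDl// /M (bigD1 j)//= lerDl sumr_ge0//.
Qed.

End BoxTopology.

(** * Faces after attaching a top cell *)

Section AttachTopology.
Context {R : realType} (d : nat) (X : cell_complex) (A : set X).
Context (h : sphere R d -> A).
Local Notation base := (@from_base R d X).
Local Notation disc := (@from_disk R d X).

Lemma disk_sphere_closed : closed [set x : disk R d | sphere R d (set_val x)].
Proof.
pose q (x : disk R d) : R := \sum_i (set_val x : 'rV[R]_d) 0 i ^+ 2.
suff qc : continuous q.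
  exact: (proj1 (continuous_closedP q) qc _ (@closed_eq R 1)).
apply: continuous_big => [|i _].
  exact: add_continuous.
move=> x; have xc := @subcoord_continuous R d (disk R d) i x.
exact: (cvgM xc xc).
Qed.

Lemma attach_closure (B P : set (@attach_sum R d X)) z :
  closed (base @^-1` P) -> closed (disc @^-1` P) ->
  (forall y z, attach_nf h y = attach_nf h z -> P y -> P z) -> B `<=` P ->
  closure (attach_proj h @` B) (attach_proj h z) -> P z.
Proof.
move=> cb cd Psat BP; apply: pi_closure_saturated => //.
  by rewrite -openC sigT_openP => -[]; rewrite preimage_setC openC.
by move=> y w /eqmodP/eqP; exact: Psat.
Qed.

Lemma attach_proj_continuous : continuous (attach_proj h).
Proof. exact: pi_continuous. Qed.

Lemma from_base_continuous : continuous base.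
Proof. by move=> x U. Qed.

Lemma from_disk_continuous : continuous disc.
Proof. by move=> x U. Qed.

Lemma attach_proj_sphere (x : disk R d) (s : sphere R d) :
  set_val x = set_val s ->
  attach_proj h (disc x) = attach_proj h (base (set_val (h s))).
Proof.
move=> xs; apply/eqmodP/eqP => /=.
by rewrite xs; case: insubP => [u _ /val_inj ->//|/negP[]]; exact: (valP s).
Qed.

Lemma from_base_inj : injective base.
Proof.
move=> x y; rewrite /from_base => xy.
by have /= := congr1 (fun z : @attach_sum R d X =>
  match z with existT true u => u | existT false _ => x end) xy.
Qed.

Hypothesis h_cont : continuous h.

(** Gluing the disk adds no limit points inside the base: a closed K extends to a closed saturated
    set by adding the sphere points that [h] sends into K. *)
Lemma attach_closure_base (K C : set X) (x : X) : closed K -> C `<=` K ->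
  closure ((attach_proj h \o base) @` C) (attach_proj h (base x)) -> K x.
Proof.
move=> cK CK.
pose P (z : @attach_sum R d X) := exists2 y, K y & attach_nf h z = base y.
have baseP : base @^-1` P = K.
  apply/seteqP; split=> [y [w Kw]|y Ky]; last by exists y.
  by move=> /from_base_inj ->.
have discP : disc @^-1` P = [set y : disk R d |
    exists2 s, set_val s = set_val y & K (set_val (h s))].
  apply/seteqP; split=> y /=.
    move=> [w Kw] /=; case: insubP => [s _ sy|]; last by [].
    by move=> /from_base_inj hs; exists s => //; rewrite hs.
  move=> [s sy Ks]; exists (set_val (h s)) => //=.
  rewrite -sy; case: insubP => [u _ /val_inj ->//|/negP[]]; exact: (valP s).
have closedP : closed (disc @^-1` P).
  have hK : closed (h @^-1` (set_val @^-1` K)).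
    apply: (proj1 (continuous_closedP h) h_cont).
    by apply: (proj1 (continuous_closedP _)) cK; exact: initial_continuous.
  (* The complement of the preimage of K is open in the sphere, hence the trace of an open W of the
     ambient space; this carries closedness from the sphere to the disk. *)
  have [W oW WE] : open (~` (h @^-1` (set_val @^-1` K))) by rewrite openC.
  rewrite (_ : _ @^-1` P = [set y : disk R d | sphere R d (set_val y)] `&`
      ~` (set_val @^-1` W)).
    apply: closedI; first exact: disk_sphere_closed.
    apply: open_closedC; apply: open_comp => // y _.
    exact: set_val_continuous.
  rewrite discP; apply/seteqP; split=> y /=.
    move=> [s <- Ks]; split; first exact: set_valP.
    by move=> Ws; have : (~` (h @^-1` (set_val @^-1` K))) s by rewrite -WE.
  move=> [sy Wy]; exists (exist _ (set_val y) (mem_set sy)) => //.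
  apply: contrapT => nK; apply: Wy.
  suff: (set_val @^-1` W) (exist _ (set_val y) (mem_set sy) : sphere R d) by [].
  by rewrite WE.
rewrite -image_comp => cx; suff: (base @^-1` P) x by rewrite baseP.
apply: attach_closure closedP _ _ cx; first by rewrite baseP.
- by move=> y z yz [w Kw yw]; exists w; rewrite // -yz.
- by move=> _ [y Cy <-]; exists y => //; exact: CK.
Qed.

Lemma face_attach_base (s t : cells X) :
  face (attach h) (Some s) (Some t) <-> face X s t.
Proof.
split=> [st x sx|st _ [x sx <-]].
  apply: (@attach_closure_base (closure (cell t)) (cell t)).
  - exact: closed_closure.
  - exact: subset_closure.
  - by apply: st; exists x.
apply: closure_image (st _ sx) => y.
apply: continuous_comp; first exact: from_base_continuous.
exact: attach_proj_continuous.
Qed.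

(** The image of the base is closed and misses the centre of the disk. *)
Lemma face_attach_top_base (s : cells X) : ~ face (attach h) None (Some s).
Proof.
have d0 : disk R d 0 by rewrite /disk/= big1// => i _; rewrite mxE expr0n.
have s0 : ~ sphere R d 0.
  rewrite /sphere/= big1 => [/esym/eqP|i _]; first by rewrite oner_eq0.
  by rewrite mxE expr0n.
pose o : disk R d := exist _ 0 (mem_set d0).
pose P (z : @attach_sum R d X) := exists y, attach_nf h z = base y.
move=> Ns; have : P (disc o); last first.
  by case=> y /=; case: insubP => // u /set_mem.
have {Ns} :
    closure (attach_proj h @` (base @` cell s)) (attach_proj h (disc o)).
  by rewrite image_comp; apply: Ns; exists o.
apply: attach_closure.
- rewrite (_ : _ @^-1` P = setT); first exact: closedT.
  by apply/seteqP; split=> // y _; exists y.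
- rewrite (_ : _ @^-1` P = [set y : disk R d | sphere R d (set_val y)]).
    exact: disk_sphere_closed.
  apply/seteqP; split=> y; first by case=> z /=; case: insubP => // u /set_mem.
  by rewrite /P /= => sy; case: insubP => [u _ _|/negP[]];
    [exists (set_val (h u))|exact: mem_set].
- by move=> y z yz [w yw]; exists w; rewrite -yz.
- by move=> _ [y _ <-]; exists y.
Qed.

(** The closure of the open disk adds exactly the image of the sphere, which is all of A since [h]
    is surjective. *)
Lemma face_attach_top (s : cells X) :
  closed A -> (forall x : A, exists u, h u = x) ->
  face (attach h) (Some s) None <-> cell s `<=` A.
Proof.
move=> cA hsurj; split=> [sN x sx|sA _ [x sx <-]].
  (* Points of the open disk satisfy P vacuously, since their normal form is not in the base; on the
     base P is A. *)
  pose P (z : @attach_sum R d X) := forall y, attach_nf h z = base y -> A y.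
  suff : P (base x) by apply.
  have {sN} : closure
      (attach_proj h @` (disc @` [set x | ~ sphere R d (set_val x)]))
      (attach_proj h (base x)).
    by rewrite image_comp; apply: sN; exists x.
  apply: attach_closure.
  - rewrite (_ : _ @^-1` P = A)//; apply/seteqP; split=> [y|y Ay z].
      by apply.
    by move=> /from_base_inj <-.
  - rewrite (_ : _ @^-1` P = setT); first exact: closedT.
    apply/seteqP; split=> // y _ z /=.
    case: insubP => // u _ _ /from_base_inj <-.
    exact: set_valP.
  - by move=> y z yz Py w zw; apply: Py; rewrite yz.
  - move=> _ [y ny <-] w /=; case: insubP => // u _ uy.
    by case: ny; rewrite -uy; exact: set_valP.
have [u hu] := hsurj (exist _ x (mem_set (sA _ sx))).
have Su : sphere R d (set_val u) := set_valP u.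
have Du : disk R d (set_val u) by rewrite /disk/= Su.
pose v : disk R d := exist _ (set_val u) (mem_set Du).
have -> : (attach_proj h \o base) x = attach_proj h (disc v).
  by rewrite (@attach_proj_sphere v u)// hu.
apply: (@closure_image _ _ (attach_proj h \o disc)) => [y|].
  apply: continuous_comp; first exact: from_disk_continuous.
  exact: attach_proj_continuous.
(* The radius from the sphere point to the centre stays in the open disk. *)
apply: (@segment_closure _ _ _ _ _ 0) => t t0 t1.
have sumE : \sum_i ((1 - t) *: (set_val u : 'rV_d)) 0 i ^+ 2 = (1 - t) ^+ 2.
  under eq_bigr do rewrite mxE exprMn.
  by rewrite -mulr_sumr Su mulr1.
have D : disk R d ((1 - t) *: (set_val u : 'rV_d)).
  by rewrite /disk/= sumE; nra.
exists (exist _ ((1 - t) *: set_val u) (mem_set D) : disk R d) => [|i] /=.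
  rewrite /sphere/= sumE => /eqP; rewrite sqrf_eq1 => /orP[]/eqP; lra.
rewrite !mxE; lra.
Qed.

End AttachTopology.

(** * Faces after collapsing a subspace *)

Section CollapseTopology.
Context (X : cell_complex) (A : set X).

Lemma collapse_closure (B P : set X) x :
  closed P -> (forall y z, A y -> A z -> P y -> P z) -> B `<=` P ->
  closure (collapse_proj A @` B) (collapse_proj A x) -> P x.
Proof.
move=> cP PA BP; apply: pi_closure_saturated => //.
by move=> y z /eqmodP/asboolP[->//|[]]; exact: PA.
Qed.

Lemma collapse_proj_continuous : continuous (collapse_proj A).
Proof. exact: pi_continuous. Qed.

Hypothesis A_closed : closed A.

Lemma face_collapse_cells (s t : cells (collapse X A)) u v :
  s = Some u -> t = Some v -> 
  cell (val u) `&` A = set0 ->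
  face (collapse X A) s t <-> face X (val u) (val v).
Proof.
move=> -> -> uA; split=> [uv x ux|uv _ [x ux <-]]; last first.
  by apply: closure_image (uv _ ux); exact: collapse_proj_continuous.
have nAx : ~ A x by move=> Ax; have : (cell (val u) `&` A) x by []; rewrite uA.
(* Adding A makes the closure saturated, at no cost because x is not in A. *)
have : (closure (cell (val v)) `|` A) x; last by case.
apply: collapse_closure (uv _ _); last by exists x.
- by apply: closedU => //; exact: closed_closure.
- by move=> y z _ Az _; right.
- by move=> y vy; left; exact: subset_closure.
Qed.

Lemma face_collapse_cells_point u : ~ face (collapse X A) (Some u) None.
Proof.
case: u => c cA uN; have /asboolPn := cA; apply => x cx.
by apply: (@collapse_closure A A) => //; apply: uN; exists x.
Qed.

(** All points of A are identified, so one common point suffices; a closure that misses A is already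
    saturated. *)
Lemma face_collapse_point u : A !=set0 ->
  face (collapse X A) None (Some u) <-> closure (cell (val u)) `&` A !=set0.
Proof.
move=> [x Ax]; split=> [Nu|[y [uy Ay]] _ [z Az <-]]; last first.
  have -> : collapse_proj A z = collapse_proj A y.
    by apply/eqmodP/asboolP; right.
  by apply: closure_image uy; exact: collapse_proj_continuous.
apply: contrapT => nA.
have : closure (cell (val u)) x.
  apply: collapse_closure (Nu _ _); last by exists x.
  - exact: closed_closure.
  - by move=> y z Ay Az uy; case: nA; exists y.
  - exact: subset_closure.
by move=> ux; apply: nA; exists x.
Qed.

End CollapseTopology.

(** * Cubes of a box and their faces *)

(* Twice the distance from the lower end of the interval to the midpoint of   *)
(* the elementary interval, so that edges are the odd codes.                  *)
Definition ecode k (e : 'I_k.+1 + 'I_k) : nat :=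
  match e with inl j => j.*2 | inr j => j.*2.+1 end.

(* Junk for [m > k.*2]. *)
Definition edecode k (m : nat) : 'I_k.+1 + 'I_k :=
  if odd m then if insub m./2 is Some j then inr j else inl ord0
  else inl (inord m./2).

Lemma ecode_le k (e : 'I_k.+1 + 'I_k) : (ecode e <= k.*2)%N.
Proof. by case: e => j /=; have := ltn_ord j; lia. Qed.

Lemma edecodeK k m : (m <= k.*2)%N -> ecode (edecode k m) = m.
Proof.
move=> mk; rewrite /edecode; case: ifPn => om /=.
  by case: insubP => [u _ /= ->|]; lia.
by rewrite inordK; lia.
Qed.

Lemma ecode_inj k : injective (@ecode k).
Proof.
case=> [i|i] [j|j] /= ij; try lia;
  by have /val_inj -> : val i = val j by move: ij => /=; lia.
Qed.

Lemma ecodeK k : cancel (@ecode k) (edecode k).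
Proof. by move=> e; apply: ecode_inj; rewrite edecodeK// ecode_le. Qed.

Lemma is_edge_code k (e : 'I_k.+1 + 'I_k) : is_edge e = odd (ecode e).
Proof. by case: e => j /=; lia. Qed.

Definition code_face (m m' : nat) : bool :=
  (m == m') || odd m' && ((m == m'.+1) || (m.+1 == m')).

Lemma code_face_trans : transitive code_face.
Proof. by move=> y x z; rewrite /code_face; lia. Qed.

(** Of two adjacent codes exactly one is odd, and the shift exchanges which one. *)
Lemma code_face_dual m m' : code_face m'.+1 m.+1 = code_face m m'.
Proof. by rewrite /code_face; lia. Qed.

Section Elementary.
Context {R : realType}.
Implicit Types (a x : R).

(** The form with centre and radius treats points and edges alike: the radius of the closure is half
    the parity of the code. *)
Definition open_interval a (m : nat) x : bool :=
  if odd m then `|x - (a + m%:R / 2)| < 2^-1 else x == a + m%:R / 2.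

Definition closed_interval a (m : nat) x : bool :=
  `|x - (a + m%:R / 2)| <= (odd m)%:R / 2.

Lemma elementaryE a k (e : 'I_k.+1 + 'I_k) x :
  elementary a e x <-> open_interval a (ecode e) x.
Proof.
rewrite /open_interval; case: e => j /=; rewrite odd_double /=.
  by rewrite -muln2 natrM mulfK ?pnatr_eq0//; split=> [->|/eqP].
rewrite in_itv /= -(natr1 j) -(natr1 j.*2) -muln2 natrM ltr_norml.
split=> /andP[? ?]; apply/andP; split; lra.
Qed.

(** The two truncated differences add up to the natural-number distance, which turns tests at
    half-integers into integer arithmetic. *)
Lemma half_dist a (m n : nat) :
  `|a + m%:R / 2 - (a + n%:R / 2)| = ((m - n) + (n - m))%:R / 2.
Proof.
rewrite opprD addrACA subrr add0r -mulrBl normrM.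
rewrite (@ger0_norm _ 2^-1) ?invr_ge0//.
congr (_ / _); have [mn|/ltnW mn] := leqP m n.
  by rewrite (eqP mn) add0n natrB// distrC ger0_norm// subr_ge0 ler_nat.
by rewrite (eqP mn) addn0 natrB// ger0_norm// subr_ge0 ler_nat.
Qed.

Lemma open_interval_half a (m z : nat) :
  open_interval a m (a + z%:R / 2) = (m == z).
Proof.
rewrite /open_interval half_dist -[X in _ < X]mul1r ltr_pM2r ?invr_gt0//.
rewrite ltrn1 (inj_eq (addrI _)).
rewrite (inj_eq (mulIf _)) ?invr_eq0 ?pnatr_eq0// eqr_nat.
by case: ifP; lia.
Qed.

Lemma closed_interval_half a (m z : nat) :
  closed_interval a m (a + z%:R / 2) = code_face z m.
Proof.
rewrite /closed_interval half_dist ler_pM2r ?invr_gt0// ler_nat /code_face.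
by lia.
Qed.

Lemma open_closed_interval a (m m' : nat) x :
  code_face m m' -> open_interval a m x -> closed_interval a m' x.
Proof.
rewrite /open_interval => mm'; case: ifPn => [om|_ /eqP ->]; last first.
  by rewrite closed_interval_half.
have -> : m' = m by move: mm'; rewrite /code_face; lia.
by rewrite /closed_interval om mul1r => /ltW.
Qed.

Lemma closed_open_interval a m x t : 0 < t -> t <= 1 -> closed_interval a m x ->
  open_interval a m (x + t * (a + m%:R / 2 - x)).
Proof.
rewrite /open_interval /closed_interval => t0 t1; set c := a + _.
case: ifPn => _; last first.
  rewrite mul0r normr_le0 subr_eq0 => /eqP ->; apply/eqP; ring.
rewrite mul1r => xc.
rewrite (_ : _ - c = (1 - t) * (x - c)); last ring.
rewrite normrM ger0_norm ?subr_ge0//.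
have := normr_ge0 (x - c); nra.
Qed.

End Elementary.

Section Box.
Context {R : realType} {d : nat} (a : 'rV[R]_d) (k : 'I_d -> nat).
Implicit Types (c : cube_index k).

Lemma cellE c (x : set_type (box a k)) :
  cell (c : cells (box_complex a k)) x <->
  forall i, open_interval (a 0 i) (ecode (c i)) ((set_val x : 'rV[R]_d) 0 i).
Proof. by split=> H i; apply/elementaryE; exact: H. Qed.

Definition center c : 'rV[R]_d := \row_i (a 0 i + (ecode (c i))%:R / 2).

Lemma center_box c : box a k (center c).
Proof.
move=> i; rewrite mxE.
have := ecode_le (c i); rewrite -(ler_nat R) -muln2 natrM => ck.
have := ler0n R (ecode (c i)) => c0.
by apply/andP; split; lra.
Qed.

Definition box_center c : set_type (box a k) :=
  exist _ (center c) (mem_set (center_box c)).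

Lemma box_centerE c i :
  (set_val (box_center c) : 'rV[R]_d) 0 i = a 0 i + (ecode (c i))%:R / 2.
Proof. by rewrite mxE. Qed.

Lemma cell_center c : cell (c : cells (box_complex a k)) (box_center c).
Proof. by apply/cellE => i; rewrite box_centerE open_interval_half. Qed.

(** Segments towards the centre enter the open cube immediately; conversely, each coordinate
    confines the cube to a closed slab. *)
Lemma closure_cellE c (x : set_type (box a k)) :
  closure (cell (c : cells (box_complex a k))) x <->
  forall i, closed_interval (a 0 i) (ecode (c i)) ((set_val x : 'rV[R]_d) 0 i).
Proof.
split=> [cx|cx]; last first.
  apply: (@segment_closure _ _ _ _ _ (center c)) => t t0 t1.
  have yb : box a k (set_val x + t *: (center c - set_val x)).
    move=> i; have := set_valP x => /(_ i); rewrite -set_valE.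
    have := center_box c i; rewrite !mxE.
    move: (_ + _ / 2) (set_val x _ _) => v y /andP[? ?] /andP[? ?].
    have t1' : 0 <= 1 - t by rewrite subr_ge0.
    by apply/andP; split; nra.
  exists (exist _ (set_val x + t *: (center c - set_val x)) (mem_set yb)
     : set_type (box a k)).
    by apply/cellE => i; rewrite /= !mxE; exact: closed_open_interval.
  by move=> i; rewrite /= !mxE.
move=> i.
pose m := a 0 i + (ecode (c i))%:R / 2.
pose r : R := (odd (ecode (c i)))%:R / 2.
pose F := (fun x : set_type (box a k) => (set_val x : 'rV[R]_d) 0 i) @^-1`
  [set` `[m - r, m + r]].
have : F x.
  apply: closure_sub_closed cx; last first.
    move=> y /cellE/(_ i)/open_closed_interval-/(_ (ecode (c i))).
    by rewrite /code_face eqxx => /(_ isT); rewrite /closed_interval ler_distl.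
  apply: (proj1 (continuous_closedP _)); first exact: subcoord_continuous.
  exact: itv_closed.
by rewrite /F /= in_itv /= /closed_interval ler_distl.
Qed.

(** Testing the centre of [s] alone suffices, and its coordinates are half-integers. *)
Lemma face_boxE (s t : cube_index k) : face (box_complex a k) s t <->
  forall i, code_face (ecode (s i)) (ecode (t i)).
Proof.
split=> [st i|st x /cellE sx].
  have /closure_cellE/(_ i) := st _ (cell_center s).
  by rewrite box_centerE closed_interval_half.
by apply/closure_cellE => i; exact: open_closed_interval (sx i).
Qed.

Lemma box_boundaryE (x : set_type (box a k)) : @box_boundary R d a k x <->
  exists i, (set_val x : 'rV[R]_d) 0 i = a 0 i \/
            (set_val x : 'rV[R]_d) 0 i = a 0 i + (k i)%:R.
Proof.
split=> [xI|[i xi] /nbhs_ballP[e /= e0 eB]]; last first.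
  have e2 : 0 < e / 2 by rewrite divr_gt0.
  (* Both diagonal shifts by e / 2 would stay in the box, yet one of them leaves it along axis i. *)
  have B b : box a k (set_val x + const_mx ((-1) ^+ (b : bool) * (e / 2))).
    apply: eB; split=> // j l; rewrite /ball/= !mxE opprD addNKr normrN normrM.
    by rewrite normrX normrN1 expr1n mul1r gtr0_norm//; lra.
  have := B true i; have := B false i.
  rewrite !mxE /= expr0 expr1 => /andP[_ +] /andP[+ _].
  by case: xi => ->; lra.
apply: contrapT => nx; apply: xI.
have := set_valP x => xB.
rewrite -set_valE in xB.
apply: (@filter_forall _ _ (fun i (y : 'rV[R]_d) =>
  is_true (a 0 i <= y 0 i <= a 0 i + (k i)%:R)) (nbhs (set_val x))) => i.
have /andP[ax xa] := xB i.
have lx : a 0 i < set_val x 0 i.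
  by rewrite lt_neqAle ax andbT; apply/eqP => xi; apply: nx; exists i; left.
have xu : set_val x 0 i < a 0 i + (k i)%:R.
  by rewrite lt_neqAle xa andbT; apply/eqP => xi; apply: nx; exists i; right.
have := @coord_continuous R 1 d 0 i (set_val x)
  [set` `]a 0 i, a 0 i + (k i)%:R[].
rewrite nbhs_simpl /= => /(_ _)/filterS; apply.
  by move=> y /=; rewrite in_itv /= => /andP[/ltW -> /ltW ->].
by apply: near_in_itvoo; rewrite in_itv /= lx.
Qed.

Lemma box_boundary_closed : closed (@box_boundary R d a k).
Proof.
apply: (proj1 (continuous_closedP (@set_val _ (box a k)))
  (@set_val_continuous R d _) (~` interior (box a k))).
exact/open_closedC/open_interior.
Qed.

Definition code_boundary (k m : nat) : bool := (m == 0%N) || (m == k.*2).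

Lemma ends_half (i : 'I_d) (x : R) : x = a 0 i \/ x = a 0 i + (k i)%:R <->
  exists2 m, code_boundary (k i) m & x = a 0 i + m%:R / 2.
Proof.
have E0 : a 0 i = a 0 i + 0%:R / 2 by rewrite mul0r addr0.
have Ek : a 0 i + (k i)%:R = a 0 i + (k i).*2%:R / 2.
  by rewrite -muln2 natrM mulfK// pnatr_eq0.
rewrite Ek {1}E0; split=> [[->|->]|[m /orP[]/eqP -> ->]].
- by exists 0%N.
- by exists (k i).*2 => //; rewrite /code_boundary eqxx orbT.
- by left.
- by right.
Qed.

(** The condition depends on the cube only, so a cube is either contained in the boundary or
    disjoint from it. *)
Lemma cell_boundary c (x : set_type (box a k)) :
  cell (c : cells (box_complex a k)) x ->
  @box_boundary R d a k x <-> exists i, code_boundary (k i) (ecode (c i)).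
Proof.
move=> /cellE cx; split=> [/box_boundaryE[i /ends_half[m mb xi]]|[i ci]].
  by exists i; have := cx i; rewrite xi open_interval_half => /eqP ->.
apply/box_boundaryE; exists i; apply/ends_half; exists (ecode (c i)) => //.
have := cx i; rewrite /open_interval ifN => [/eqP//|].
by case/orP: ci => /eqP ->; rewrite ?odd_double.
Qed.

Lemma cell_sub_boundary c :
  cell (c : cells (box_complex a k)) `<=` @box_boundary R d a k <->
  exists i, code_boundary (k i) (ecode (c i)).
Proof.
split=> [cb|cb x cx]; last exact/(cell_boundary cx).
apply/(cell_boundary (cell_center c)); exact: cb (cell_center c).
Qed.

Lemma cell_disjoint_boundary c :
  ~ (exists i, code_boundary (k i) (ecode (c i))) ->
  cell (c : cells (box_complex a k)) `&` @box_boundary R d a k = set0.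
Proof.
move=> nc; apply/seteqP; split=> // x [cx xb]; apply: nc.
exact/(cell_boundary cx).
Qed.

Lemma closure_cell_boundary c :
  closure (cell (c : cells (box_complex a k))) `&` @box_boundary R d a k
    !=set0 <->
  exists i, exists2 m, code_face m (ecode (c i)) & code_boundary (k i) m.
Proof.
split=> [[x [/closure_cellE cx /box_boundaryE[i /ends_half[m mb xi]]]]|].
  by exists i, m => //; have := cx i; rewrite xi closed_interval_half.
case=> i [m mc mb].
(* Replacing the i-th code of [c] by the end code m gives a boundary face of [c], whose centre is
   the witness. *)
pose b : cube_index k := [ffun j => if j == i then edecode (k j) m else c j].
have bE j : ecode (b j) = if j == i then m else ecode (c j).
  rewrite ffunE; case: eqP => // ->; apply: edecodeK.
  by case/orP: mb => /eqP ->.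
exists (box_center b); split.
  apply/closure_cellE => j; rewrite box_centerE closed_interval_half bE.
  by case: eqP => [->//|_]; rewrite /code_face eqxx.
by apply/(cell_boundary (cell_center b)); exists i; rewrite bE eqxx.
Qed.

Lemma box_boundary_neq0 : (0 < d)%N -> @box_boundary R d a k !=set0.
Proof.
move=> d0; pose b : cube_index k := [ffun j => edecode (k j) 0].
exists (box_center b); apply/(cell_boundary (cell_center b)).
by exists (Ordinal d0); rewrite ffunE edecodeK.
Qed.

End Box.

(** * Duality between boxes *)

Section Orders.
Context {R : realType}.

(** The relation is arbitrary because it is used both for the sorting order on X and for its
    reversal transported to Y. *)
Lemma compatible_sorted (X : cell_complex) (f : cells X -> R)
    (leT : rel (cells X)) (o : seq (cells X)) :
  transitive leT -> perm_eq o (enum (cells X)) -> sorted leT o ->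
  (forall s t, leT s t -> f s <= f t) ->
  (forall s t, face X s t -> s = t \/ ~~ leT t s) ->
  compatible f o.
Proof.
move=> leT_trans oP oS lef leface; split=> // [s t /leface[->//|nts]|].
  have o_all u : u \in o by rewrite (perm_mem oP) mem_enum.
  by rewrite leqNgt; apply: contra nts; exact: sorted_ltn_index.
by rewrite sorted_map; apply: sub_sorted oS => s t /lef.
Qed.

Lemma dual_filtered_opp d (X Y : cell_complex) (f : cells X -> R)
    (g : cells Y -> R) (star : cells X -> cells Y) :
  monotonic f -> combinatorial_duality d star ->
  (forall s t, face X s t -> s = t \/ (cell_dim s < cell_dim t)%N) ->
  (forall s, g (star s) = - f s) ->
  dual_filtered d X Y f g.
Proof.
move=> fm star_dual dimX gE.
have [_ _ [unstar starK unstarK] _ star_face] := star_dual.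
split=> //.
  move=> u v; rewrite -(unstarK u) -(unstarK v) !gE lerN2 => /star_face.
  exact: fm.
exists star => //.
pose leT s t := (f s < f t) || (f s == f t) && (cell_dim s <= cell_dim t)%N.
have leTf s t : leT s t -> f s <= f t.
  by case/orP=> [/ltW//|/andP[/eqP-> _]].
have leT_total : total leT.
  by move=> s t; rewrite /leT; case: ltgtP => //= _; exact: leq_total.
have leT_trans : transitive leT.
  move=> t s u /orP[st|/andP[/eqP st dst]] /orP[tu|/andP[/eqP tu dtu]];
    rewrite /leT.
  - by rewrite (lt_trans st tu).
  - by rewrite -tu st.
  - by rewrite st tu.
  - by rewrite st tu eqxx (leq_trans dst dtu) orbT.
(* At equal values the dimension decides, so a proper face strictly precedes. *)
have leTface s t : face X s t -> s = t \/ ~~ leT t s.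
  move=> st; have [->|dst] := dimX _ _ st; [by left|right].
  by rewrite /leT negb_or -leNgt fm//= negb_and -ltnNge dst orbT.
pose o := sort leT (enum (cells X)).
have oP : perm_eq o (enum (cells X)) by rewrite perm_sort.
exists o.
  by apply: (@compatible_sorted _ _ leT) => //; exact: sort_sorted.
apply: (@compatible_sorted _ _ (fun u v => leT (unstar v) (unstar u))).
- by move=> v u w uv vw; exact: leT_trans vw uv.
- apply: uniq_perm; rewrite ?enum_uniq// ?rev_uniq ?map_inj_uniq//
    ?(perm_uniq oP)//.
  + exact: enum_uniq.
  + exact: can_inj starK.
  move=> u; rewrite mem_rev mem_enum -(unstarK u) mem_map.
    by rewrite (perm_mem oP) mem_enum.
  exact: can_inj starK.
- rewrite rev_sorted sorted_map; apply: sub_sorted (sort_sorted leT_total _).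
  by move=> s t /=; rewrite !starK.
- move=> u v /leTf; rewrite -{2}(unstarK u) -{2}(unstarK v) !gE lerN2; exact.
move=> u v; rewrite -{1}(unstarK u) -{1}(unstarK v) => /star_face/leTface.
by case=> [E|]; [left; rewrite -(unstarK u) -E unstarK|right].
Qed.

End Orders.

Section BoxDuality.
Context {R : realType} {d : nat} (a b : 'rV[R]_d) (k k' : 'I_d -> nat).
Hypothesis kk' : forall i, k' i = (k i).+1.
Local Notation X := (box_complex a k).
Local Notation Y := (box_complex b k').
Local Notation bdX := (@box_boundary R d a k).
Local Notation bdY := (@box_boundary R d b k').

Definition dual_cube (c : cube_index k) : cube_index k' :=
  [ffun i => edecode (k' i) (ecode (c i)).+1].

Definition undual_cube (c : cube_index k') : cube_index k :=
  [ffun i => edecode (k i) (ecode (c i)).-1].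

Lemma code_dual_cube c i : ecode (dual_cube c i) = (ecode (c i)).+1.
Proof. by rewrite ffunE edecodeK// kk'; have := ecode_le (c i); lia. Qed.

Lemma dual_cubeK : cancel dual_cube undual_cube.
Proof. by move=> c; apply/ffunP => i; rewrite ffunE code_dual_cube ecodeK. Qed.

Lemma dual_cube_interior c : ~~ `[< cell (dual_cube c : cells Y) `<=` bdY >].
Proof.
apply/asboolPn => /cell_sub_boundary[i].
rewrite code_dual_cube /code_boundary kk'; have := ecode_le (c i); lia.
Qed.

Lemma undual_cubeK (c : cube_index k') :
  ~~ `[< cell (c : cells Y) `<=` bdY >] -> dual_cube (undual_cube c) = c.
Proof.
move=> /asboolPn nc; apply/ffunP => i; apply: ecode_inj.
rewrite code_dual_cube ffunE.
(* An interior code is neither 0 nor 2 k'_i, so its predecessor is not truncated and is at most 2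
   k_i. *)
have : ~~ code_boundary (k' i) (ecode (c i)).
  by apply/negP => ci; apply: nc; apply/cell_sub_boundary; exists i.
have := ecode_le (c i); have := kk' i; rewrite /code_boundary => ki ck cb.
by rewrite edecodeK; lia.
Qed.

Context (h : sphere R d -> bdX) (h_homeo : homeomorphism h).

Definition dual_cell (s : cells (attach h)) : cells (collapse Y bdY) :=
  if s is Some c then Some (exist _ (dual_cube c) (dual_cube_interior c))
  else None.

Definition undual_cell (s : cells (collapse Y bdY)) : cells (attach h) :=
  if s is Some c then Some (undual_cube (val c)) else None.

Lemma dual_cellK : cancel dual_cell undual_cell.
Proof. by case=> [c|//]; rewrite /= dual_cubeK. Qed.

Lemma undual_cellK : cancel undual_cell dual_cell.
Proof.
by case=> [[c ci]|//] /=; congr Some; apply: val_inj; rewrite /= undual_cubeK.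
Qed.

(** The shift changes every parity, so the edge directions of a cube and of its dual are
    complementary. *)
Lemma dual_cell_dim s : (cell_dim (dual_cell s) + cell_dim s = d)%N.
Proof.
case: s => [c|//] /=.
rewrite -[RHS](card_ord d) -(cardsC [set i | is_edge (c i)]%SET) addnC.
congr (_ + _)%N; apply: eq_card => i.
by rewrite !inE !is_edge_code code_dual_cube.
Qed.

Hypothesis d_gt0 : (0 < d)%N.

Lemma dual_cell_face s t :
  face (attach h) s t <-> face (collapse Y bdY) (dual_cell t) (dual_cell s).
Proof.
have [h_cont [g [_ _ gK]]] := h_homeo.
have h_surj (x : bdX) : exists u, h u = x by exists (g x).
have cX := @box_boundary_closed R d a k.
have cY := @box_boundary_closed R d b k'.
case: s t => [s|] [t|].
- rewrite face_attach_base//.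
  rewrite (@face_collapse_cells _ bdY _ (dual_cell (Some t))
    (dual_cell (Some s)) _ _ erefl erefl)//; last first.
    apply/cell_disjoint_boundary/cell_sub_boundary/asboolPn.
    exact: dual_cube_interior.
  split=> /face_boxE st; apply/face_boxE => i; move: (st i);
    by rewrite /= !code_dual_cube code_face_dual.
- rewrite face_attach_top// (@face_collapse_point _ bdY)//; last first.
    exact: box_boundary_neq0.
  rewrite closure_cell_boundary cell_sub_boundary.
  (* The end codes 0 and 2 k_i become 1 and 2 k_i + 1, the interior codes whose edges touch the ends
     0 and 2 k_i + 2 of the larger box. *)
  split=> [[i si]|[i [m ms mb]]]; exists i.
    rewrite /= code_dual_cube; case/orP: si => /eqP ->.
      by exists 0%N.
    exists (k i).+1.*2; last by rewrite /code_boundary kk' eqxx orbT.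
    by rewrite /code_face; lia.
  move: ms mb; rewrite /= code_dual_cube /code_face /code_boundary kk'.
  have := ecode_le (s i); set c := ecode (s i); move: c => c; lia.
- by split=> [/face_attach_top_base|/(face_collapse_cells_point cY)].
- by split=> _; exact: subset_closure.
Qed.

(** Passing to a face only loses edge directions, and a code that changes loses one; a boundary cube
    has an even code, hence fewer than d directions. *)
Lemma attach_box_face_dim (s t : cells (attach h)) :
  face (attach h) s t -> s = t \/ (cell_dim s < cell_dim t)%N.
Proof.
have [h_cont [g [_ _ gK]]] := h_homeo.
have h_surj (x : bdX) : exists u, h u = x by exists (g x).
have cX := @box_boundary_closed R d a k.
case: s t => [s|] [t|]; [| | by move/face_attach_top_base|by left].
  move=> /(face_attach_base h_cont)/face_boxE st.
  have [|neq] := eqVneq s t; [by left; congr Some|right].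
  have [i si] : exists i, ecode (s i) != ecode (t i).
    apply: contrapT => nst; case/eqP: neq; apply/ffunP => i; apply: ecode_inj.
    by apply: contrapT => /eqP nsti; apply: nst; exists i.
  apply/proper_card/fintype.properP; split.
    apply/fintype.subsetP => j; rewrite !inE !is_edge_code.
    by have := st j; rewrite /code_face; lia.
  exists i; rewrite !inE !is_edge_code; have := st i;
    by rewrite /code_face; lia.
move/(face_attach_top s cX h_surj)/cell_sub_boundary => [i si]; right.
rewrite /= -[X in (_ < X)%N]card_ord -cardsT.
apply/proper_card/fintype.properP; split.
  by apply/fintype.subsetP => j; rewrite inE.
exists i; first by rewrite inE.
rewrite inE is_edge_code.
by case/orP: si => /eqP ->; rewrite ?odd_double.
Qed.

Lemma dimension_box_attach : dimension (attach h) = d.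
Proof.
apply/eqP; rewrite eqn_leq; apply/andP; split.
  by apply/bigmax_leqP => s _; have := dual_cell_dim s; lia.
exact: (@leq_bigmax _ _ (None : cells (attach h))).
Qed.

Lemma dimension_box_collapse : dimension (collapse Y bdY) = d.
Proof.
apply/eqP; rewrite eqn_leq; apply/andP; split.
  by apply/bigmax_leqP => s _; have := dual_cell_dim (undual_cell s);
    rewrite undual_cellK; lia.
(* The dual of a corner vertex attains dimension d. *)
pose v : cells (attach h) := Some [ffun i => edecode (k i) 0].
have v0 : cell_dim v = 0%N.
  apply/eqP; rewrite /= cards_eq0; apply/eqP/setP => i.
  by rewrite !inE is_edge_code ffunE edecodeK.
have := dual_cell_dim v; rewrite v0 addn0 => {1}<-.
exact: (@leq_bigmax _ _ (dual_cell v)).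
Qed.

(** The bound by [N] is what makes the extension to the attached d-cell monotonic. *)
Lemma box_dual_filtered (f : cube_index k -> R) (g : cube_index k' -> R)
    (N : R) :
  (forall s t : cube_index k,
     (forall i, code_face (ecode (s i)) (ecode (t i))) -> f s <= f t) ->
  (forall s, f s <= N) ->
  (forall s, g (dual_cube s) = - f s) ->
  dual_filtered d (attach h) (collapse Y bdY)
    (attach_fun h f N) (@collapse_fun Y bdY R g (- N)).
Proof.
move=> fm fN gf; apply: (@dual_filtered_opp _ _ _ _ _ _ dual_cell).
- have [h_cont _] := h_homeo.
  case=> [s|] [t|];
    [|by move=> _; exact: fN|by move/face_attach_top_base|by []].
  by move=> /(face_attach_base h_cont)/face_boxE; exact: fm.
- split; [exact: dimension_box_attach|exact: dimension_box_collapse| | |].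
  + by exists undual_cell; [exact: dual_cellK|exact: undual_cellK].
  + exact: dual_cell_dim.
  + exact: dual_cell_face.
- exact: attach_box_face_dim.
- by case=> [s|] /=; rewrite ?gf.
Qed.

End BoxDuality.

(** * Filtrations of images *)

Section ImageFunctions.
Context {R : realType} {d : nat} (lo hi : 'I_d -> nat).
Implicit Types (p : grid lo hi) (J : grid lo hi -> R).

Lemma grid_bounds p i : (lo i <= val p i <= hi i)%N.
Proof. by have /forallP := valP p; apply. Qed.

(** Coordinates are bounded by M, so all values occur in a finite list. The bound keeps [inf] from
    taking its default value. *)
Lemma grid_has_lbound J : exists B, forall p, B <= J p.
Proof.
pose M := (\max_i hi i)%N.
pose s := pmap (fun c : {ffun 'I_d -> 'I_M.+1} =>
  omap J (insub [ffun i => c i : nat])) (enum {ffun 'I_d -> 'I_M.+1}).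
exists (- \sum_(y <- s) `|y|) => p; rewrite lerNl.
have : J p \in s.
  rewrite mem_pmap; apply/mapP; exists [ffun i => inord (val p i)].
    by rewrite mem_enum.
  rewrite (_ : [ffun _ => _] = val p) ?valK//; apply/ffunP => i.
  rewrite !ffunE inordK// ltnS; have /andP[_ /leq_trans] := grid_bounds p i.
  by apply; exact: leq_bigmax.
move=> /(@perm_to_rem _ (J p)) /(perm_big _) ->; rewrite big_cons /=.
rewrite (le_trans (ler_norm _))// normrN lerDl; exact: sumr_ge0.
Qed.

Lemma Tcenter p i :
  @Tcorner R d lo 0 i + (val p i - lo i).*2.+1%:R / 2 = (val p i)%:R.
Proof.
have /andP[lp _] := grid_bounds p i.
rewrite mxE -(natr1 _.*2) -muln2 natrM natrB//; lra.
Qed.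

(** The grid point is the centre of its voxel, and the code of the cell containing it is
    determined. *)
Lemma unit_cubeE p (q : cube_index (Tsize lo hi)) :
  set_val @` cell (q : cells (Tcomplex R lo hi)) = unit_cube_at p <->
  forall i, ecode (q i) = (val p i - lo i).*2.+1.
Proof.
split=> [qp i|qp].
  have : unit_cube_at p (grid_point p : 'rV[R]_d) by move=> j; rewrite mxE; lra.
  rewrite -qp => -[y /cellE/(_ i) + yp].
  by rewrite yp [grid_point _ _ _]mxE -Tcenter open_interval_half => /eqP.
apply/seteqP; split=> [_ [y /cellE yq <-] i|x xp].
  have := yq i; rewrite qp /open_interval /= odd_double /= Tcenter.
  by rewrite ltr_distl.
have xb : box (@Tcorner R d lo) (Tsize lo hi) x.
  move=> i; have /andP[lp ph] := grid_bounds p i.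
  have := xp i; rewrite mxE /Tsize natrB; last lia.
  have : (val p i)%:R + 1 <= (hi i).+1%:R :> R by rewrite natr1 ler_nat ltnS.
  have : (lo i)%:R <= (val p i)%:R :> R by rewrite ler_nat.
  lra.
exists (exist _ x (mem_set xb)
  : set_type (box (@Tcorner R d lo) (Tsize lo hi))) => //.
apply/cellE => i; rewrite qp /open_interval /= odd_double /= Tcenter ltr_distl.
exact: xp.
Qed.

Lemma Tfun_code J (c : cube_index (Tsize lo hi)) :
  Tfun J c = inf [set J p | p in [set p : grid lo hi |
    forall i, code_face (ecode (c i)) (val p i - lo i).*2.+1]].
Proof.
congr (inf (J @` _)); apply/seteqP; split=> p /=.
  by move=> [q /unit_cubeE qp /face_boxE cq] i; rewrite -qp.
move=> cp; pose q : cube_index (Tsize lo hi) :=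
  [ffun i => edecode (Tsize lo hi i) (val p i - lo i).*2.+1].
have qp i : ecode (q i) = (val p i - lo i).*2.+1.
  rewrite ffunE edecodeK//; have := grid_bounds p i; rewrite /Tsize; lia.
by exists q; [exact/unit_cubeE|apply/face_boxE => i; rewrite qp].
Qed.

Lemma Vcenter p i :
  @Vcorner R d lo 0 i + (val p i - lo i).*2%:R / 2 = (val p i)%:R.
Proof.
have /andP[lp _] := grid_bounds p i.
rewrite mxE -muln2 natrM natrB//; lra.
Qed.

Lemma vertexE p (v : cube_index (Vsize lo hi)) :
  set_val @` cell (v : cells (Vcomplex R lo hi)) = [set grid_point p] <->
  forall i, ecode (v i) = (val p i - lo i).*2.
Proof.
split=> [vp i|vp].
  have : [set grid_point p] (grid_point p : 'rV[R]_d) by [].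
  rewrite -vp => -[y /cellE/(_ i) + yp].
  by rewrite yp [grid_point _ _ _]mxE -Vcenter open_interval_half => /eqP.
have vE : set_val (box_center (@Vcorner R d lo) v) = grid_point p.
  by apply/rowP => i; rewrite box_centerE vp Vcenter mxE.
apply/seteqP; split=> [_ [y /cellE yv <-]|x ->].
  apply/rowP => i; have := yv i.
  by rewrite vp /open_interval odd_double Vcenter mxE => /eqP.
by exists (box_center (@Vcorner R d lo) v) => //; exact: cell_center.
Qed.

Lemma Vfun_code J (c : cube_index (Vsize lo hi)) :
  Vfun J c = sup [set J p | p in [set p : grid lo hi |
    forall i, code_face (val p i - lo i).*2 (ecode (c i))]].
Proof.
congr (sup (J @` _)); apply/seteqP; split=> p /=.
  by move=> [v /vertexE vp /face_boxE vc] i; rewrite -vp.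
move=> cp; pose v : cube_index (Vsize lo hi) :=
  [ffun i => edecode (Vsize lo hi i) (val p i - lo i).*2].
have vp i : ecode (v i) = (val p i - lo i).*2.
  rewrite ffunE edecodeK//; have := grid_bounds p i; rewrite /Vsize; lia.
by exists v; [exact/vertexE|apply/face_boxE => i; rewrite vp].
Qed.

Lemma Tpixel_exists (c : cube_index (Tsize lo hi)) :
  (forall i, (lo i <= hi i)%N) ->
  exists p : grid lo hi,
    forall i, code_face (ecode (c i)) (val p i - lo i).*2.+1.
Proof.
move=> lohi.
(* Halving the code selects an incident voxel; the minimum sends the far end of the box to the last
   voxel. *)
pose p := [ffun i => (lo i + minn (ecode (c i))./2 (hi i - lo i))%N].
have pP : in_grid lo hi p.
  by apply/forallP => i; rewrite ffunE; have := lohi i; lia.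
exists (exist _ p pP) => i; rewrite ffunE.
have := ecode_le (c i); have := lohi i; rewrite /Tsize /code_face; lia.
Qed.

Lemma Vvertex_exists (c : cube_index (Vsize lo hi)) :
  (forall i, (lo i <= hi i)%N) ->
  exists p : grid lo hi, forall i, code_face (val p i - lo i).*2 (ecode (c i)).
Proof.
move=> lohi; pose p := [ffun i => (lo i + (ecode (c i))./2)%N].
have pP : in_grid lo hi p.
  apply/forallP => i; rewrite ffunE; have := ecode_le (c i); have := lohi i.
  by rewrite /Vsize; lia.
exists (exist _ p pP) => i; rewrite ffunE /code_face; lia.
Qed.

End ImageFunctions.

Section Extrema.
Context {R : realType} {T : Type}.
Implicit Types (J : T -> R) (S : set T).

Lemma inf_image_opp J S : inf [set - J p | p in S] = - sup [set J p | p in S].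
Proof.
rewrite /inf image_comp; congr (- sup (_ @` _)).
by apply/funext => p /=; rewrite opprK.
Qed.

Lemma sup_image_opp J S : sup [set - J p | p in S] = - inf [set J p | p in S].
Proof. by rewrite /inf opprK image_comp. Qed.

Lemma inf_image_subset J S S' B : (forall p, B <= J p) -> S' `<=` S ->
  S' !=set0 -> inf [set J p | p in S] <= inf [set J p | p in S'].
Proof.
move=> JB SS' [p0 S'p0]; apply: lb_le_inf; first by exists (J p0), p0.
move=> _ [p Sp <-]; apply: ge_inf; last by exists p => //; exact: SS'.
by exists B => _ [q _ <-].
Qed.

Lemma sup_image_subset J S S' B : (forall p, J p <= B) -> S `<=` S' ->
  S !=set0 -> sup [set J p | p in S] <= sup [set J p | p in S'].
Proof.
move=> JB SS' S0; rewrite -lerN2 -!inf_image_opp.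
by apply: (@inf_image_subset _ _ _ (- B)) => // p; rewrite lerN2.
Qed.

End Extrema.

(** * Values on the padded image and its negative *)

Section Padding.
Context {R : realType} {d : nat} (n : 'I_d -> nat).
Context (I : grid (fun=> 1%N) n -> R) (N : R).
Hypothesis n_gt0 : forall i, (0 < n i)%N.
Hypothesis N_gt : forall p, I p < N.
Local Notation lo := (fun=> 1%N : nat).
Local Notation loP := (fun=> 0%N : nat).
Local Notation hiP := (fun i => (n i).+1).

Lemma padded_le q : padded I N q <= N.
Proof. by rewrite /padded; case: insubP => [p _ _|_]; rewrite ?lexx// ltW. Qed.

Lemma pad_grid_subproof (p : grid lo n) : in_grid loP hiP (val p).
Proof. by apply/forallP => i; have := grid_bounds p i; lia. Qed.

Definition pad_grid (p : grid lo n) : grid loP hiP :=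
  exist _ (val p) (pad_grid_subproof p).

Lemma padded_pad_grid p : padded I N (pad_grid p) = I p.
Proof. by rewrite /padded valK. Qed.

Lemma Tfun_le (c : cube_index (Tsize lo n)) : Tfun I c <= N.
Proof.
have [B IB] := grid_has_lbound I.
have [p cp] := Tpixel_exists c n_gt0.
rewrite Tfun_code; apply: le_trans (ltW (N_gt p)); apply: ge_inf.
  by exists B => _ [q _ <-].
by exists p.
Qed.

Lemma Tfun_mono (s t : cube_index (Tsize lo n)) :
  (forall i, code_face (ecode (s i)) (ecode (t i))) -> Tfun I s <= Tfun I t.
Proof.
have [B IB] := grid_has_lbound I.
move=> st; rewrite !Tfun_code; apply: (inf_image_subset IB) => [p tp i|].
  exact: code_face_trans (st i) (tp i).
by have [p tp] := Tpixel_exists t n_gt0; exists p.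
Qed.

Lemma Vfun_padded_le (c : cube_index (Vsize loP hiP)) :
  Vfun (padded I N) c <= N.
Proof.
rewrite Vfun_code; apply: ge_sup; last by move=> _ [p _ <-]; exact: padded_le.
have [//|p cp] := @Vvertex_exists _ loP hiP c.
by exists (padded I N p), p.
Qed.

Lemma Vfun_padded_mono (s t : cube_index (Vsize loP hiP)) :
  (forall i, code_face (ecode (s i)) (ecode (t i))) ->
  Vfun (padded I N) s <= Vfun (padded I N) t.
Proof.
move=> st; rewrite !Vfun_code; apply: (sup_image_subset padded_le) => [p sp i|].
  exact: code_face_trans (sp i) (st i).
by have [//|p sp] := @Vvertex_exists _ loP hiP s; exists p.
Qed.

(** Voxels around [c] are the unpadded vertices of its dual. Padded vertices contribute only -N,
    below the value at any of these voxels, of which there is at least one. *)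
Lemma Vfun_dual (c : cube_index (Tsize lo n)) :
  Vfun (fun p => - padded I N p) (dual_cube (Vsize loP hiP) c) = - Tfun I c.
Proof.
have kk i : Vsize loP hiP i = (Tsize lo n i).+1 by rewrite /Vsize /Tsize; lia.
(* Voxel p has code 2 (p_i - 1) + 1 in T(I); its shift 2 p_i is the code of vertex p in the padded
   grid. *)
have dualE (p : grid loP hiP) (u : grid lo n) i : val u = val p ->
    code_face (val p i - 0).*2 (ecode (dual_cube (Vsize loP hiP) c i)) =
    code_face (ecode (c i)) (val u i - 1).*2.+1.
  move=> <-; have := grid_bounds u i.
  rewrite (code_dual_cube kk) -[RHS]code_face_dual => u1.
  congr code_face; lia.
(* The two sets of values may differ by -N, but their downward closures coincide. *)
rewrite Vfun_code Tfun_code -sup_image_opp -[LHS]sup_down -[RHS]sup_down.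
congr sup; apply/seteqP; split=> x /downP[_ [p cp <-] xp]; apply/downP.
  move: xp; rewrite /padded; case: insubP => [u _ up|_] xp.
    by exists (- I u) => //; exists u => // i; rewrite -(dualE p).
  have [u cu] := Tpixel_exists c n_gt0; exists (- I u); first by exists u.
  by rewrite (le_trans xp)// lerN2 ltW.
exists (- I p) => //; exists (pad_grid p); last by rewrite padded_pad_grid.
by move=> i; rewrite (dualE _ p).
Qed.

(** Both grids start at 0, so vertex code 2 p_i shifts exactly to voxel code 2 p_i + 1 and the index
    sets are equal. *)
Lemma Tfun_dual (c : cube_index (Vsize loP hiP)) :
  Tfun (fun p => - padded I N p) (dual_cube (Tsize loP hiP) c) =
  - Vfun (padded I N) c.
Proof.
have kk i : Tsize loP hiP i = (Vsize loP hiP i).+1.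
  by rewrite /Vsize /Tsize; lia.
rewrite Vfun_code Tfun_code inf_image_opp; congr (- sup (_ @` _)).
apply/seteqP; split=> p cp i; have := cp i;
  by rewrite (code_dual_cube kk) code_face_dual.
Qed.

End Padding.

Theorem corollary4p10 (R : realType) (d : nat) (n : 'I_d -> nat)
    (I : grid (fun=> 1%N) n -> R) (N : R)
    (d_gt0 : (0 < d)%N) (n_gt0 : forall i, (0 < n i)%N)
    (N_gt : forall p, I p < N) :
  let lo : 'I_d -> nat := fun=> 1%N in
  let loP : 'I_d -> nat := fun=> 0%N in
  let hiP : 'I_d -> nat := fun i => (n i).+1 in
  let IP : grid loP hiP -> R := padded I N in
  let IPopp : grid loP hiP -> R := fun p => - IP p in
  (forall h : sphere R d -> Tboundary R lo n, homeomorphism h ->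
     dual_filtered d
       (attach h) (collapse (Vcomplex R loP hiP) (Vboundary R loP hiP))
       (attach_fun h (Tfun I) N)
       (collapse_fun (Vboundary R loP hiP) (Vfun IPopp) (- N)))
  /\
  (forall h : sphere R d -> Vboundary R loP hiP, homeomorphism h ->
     dual_filtered d
       (attach h) (collapse (Tcomplex R loP hiP) (Tboundary R loP hiP))
       (attach_fun h (Vfun IP) N)
       (collapse_fun (Tboundary R loP hiP) (Tfun IPopp) (- N))).
Proof.
move=> lo loP hiP IP IPopp; split=> h h_homeo.
  (* T(I), V(I^P) and T(I^P) have n_i, n_i + 1 and n_i + 2 segments along axis i, so each part
     compares consecutive sizes. *)
  apply: box_dual_filtered => //.
  - by move=> i; rewrite /Vsize /Tsize /hiP /loP /lo; lia.
  - exact: Tfun_mono.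
  - exact: Tfun_le.
  - exact: Vfun_dual.
apply: box_dual_filtered => //.
- exact: Vfun_padded_mono.
- exact: Vfun_padded_le.
- exact: Tfun_dual.
Qed.
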